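(* The class of all finite graphs has the extension property for switching automorphisms: for every finite graph $\mathbf G$ there exists a finite graph $\mathbf H$ containing $\mathbf G$ as an induced subgraph such that (1) every switching isomorphism between two induced subgraphs of $\mathbf G$ extends to a switching automorphism of $\mathbf H$, and (2) every isomorphism between two induced subgraphs of $\mathbf G$ extends to an automorphism of $\mathbf H$.
   Context: Graphs are simple and undirected. For a graph $\mathbf G$ with vertex set $G$ and $S\subseteq G$, the (Seidel) switching $\mathbf G_S$ is the graph on $G$ obtained from $\mathbf G$ by complementing the edges between $S$ and $G\setminus S$: for $s\in S$, $t\in G\setminus S$, $\{s,t\}$ is an edge of $\mathbf G_S$ iff it is not an edge of $\mathbf G$; pairs with both endpoints in $S$ or both in $G\setminus S$ are unchanged. For graphs $\mathbf G,\mathbf H$, a map $f\colon G\to H$ is a switching isomorphism of $\mathbf G$ and $\mathbf H$ if there is $S\subseteq G$ such that $f$ is an isomorphism from $\mathbf G_S$ to $\mathbf H$; if $\mathbf G=\mathbf H$ it is called a switching automorphism. *)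

(* Defs.v *)
From HB Require Import structures.
From mathcomp Require Import all_boot.

Set Implicit Arguments.
Unset Strict Implicit.
Unset Printing Implicit Defensive.

Record simple_graph := SimpleGraph {
  vertex :> finType;
  edge : rel vertex;
  edge_sym : symmetric edge;
  edge_irr : irreflexive edge
}.

Section Induced.
Variables (G : simple_graph) (A : {set G}).

Definition induced_edge : rel {x : G | x \in A} :=
  fun x y => edge (val x) (val y).

Lemma induced_edge_sym : symmetric induced_edge.
Proof. by move=> x y; apply: edge_sym. Qed.

Lemma induced_edge_irr : irreflexive induced_edge.
Proof. by move=> x; apply: edge_irr. Qed.

Definition induced : simple_graph := SimpleGraph induced_edge_sym induced_edge_irr.

End Induced.

Section Switch.
Variables (G : simple_graph) (S : {set G}).

Definition switch_edge : rel G :=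
  fun x y => if (x \in S) == (y \in S) then edge x y else ~~ edge x y.

Lemma switch_edge_sym : symmetric switch_edge.
Proof. by move=> x y; rewrite /switch_edge eq_sym edge_sym. Qed.

Lemma switch_edge_irr : irreflexive switch_edge.
Proof. by move=> x; rewrite /switch_edge eqxx edge_irr. Qed.

Definition switch : simple_graph := SimpleGraph switch_edge_sym switch_edge_irr.

End Switch.

Definition graph_embedding (G H : simple_graph) (f : G -> H) : Prop :=
  injective f /\ forall x y : G, edge (f x) (f y) = edge x y.

Definition graph_iso (G H : simple_graph) (f : G -> H) : Prop :=
  bijective f /\ forall x y : G, edge (f x) (f y) = edge x y.

Definition switching_iso (G H : simple_graph) (f : G -> H) : Prop :=
  exists S : {set G}, @graph_iso (switch S) H f.

Definition graph_aut (G : simple_graph) (h : G -> G) : Prop := graph_iso h.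

Definition switching_aut (G : simple_graph) (h : G -> G) : Prop := switching_iso h.

(* [G] is seen inside [H] through the embedding [e], so that [h] extends the
   partial map [f] of [G] when [h] agrees with [f] on the copy of [A]. *)
Definition extends (G H : simple_graph) (e : G -> H) (A B : {set G})
    (f : induced A -> induced B) (h : H -> H) : Prop :=
  forall x : induced A, h (e (val x)) = e (val (f x)).

(* Main.v *)
Require Import Defs.
From HB Require Import structures.
From mathcomp Require Import all_boot all_fingroup.

Set Implicit Arguments.
Unset Strict Implicit.
Unset Printing Implicit Defensive.

(** The vertices of [H] are pairs [(x, chi)] with [chi : G -> bool], and
    [(x, chi)], [(y, xi)] with [x != y] are adjacent iff [chi y != xi x].  A
    permutation [pi] of [G] together with [F : G -> G -> bool] acts on [H] by
    [(x, chi) |-> (pi x, chi')] with [chi' (pi y) = chi y (+) F x y].  If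
    [F x y (+) F y x = s x (+) s y], this map changes the adjacency of two
    vertices exactly as switching with respect to [s] does.  Given a partial
    switching isomorphism on [A], extended arbitrarily to a permutation [pi],
    the values [F x y] with [x] in [A] are forced by the embedding of [G] in
    [H]; the constraint is satisfied on [A] by hypothesis, and elsewhere it is
    met by choosing [F y x] for [y] outside [A]. *)

Section ValuationGraph.
Variable T : finType.

Definition valuation_edge : rel (T * {ffun T -> bool}) :=
  fun p q => (p.1 != q.1) && (p.2 q.1 (+) q.2 p.1).

Lemma valuation_edge_sym : symmetric valuation_edge.
Proof. by move=> p q; rewrite /valuation_edge eq_sym addbC. Qed.

Lemma valuation_edge_irr : irreflexive valuation_edge.
Proof. by move=> p; rewrite /valuation_edge eqxx. Qed.

Definition valuation_graph : simple_graph :=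
  SimpleGraph valuation_edge_sym valuation_edge_irr.

End ValuationGraph.

(** [A] and its image under [g] have equally large complements, so listing each set before its
    complement gives two enumerations that can be matched by position. *)
Lemma injective_in_extends_perm (T : finType) (A : {set T}) (g : T -> T) :
  {in A &, injective g} -> exists pi : {perm T}, {in A, pi =1 g}.
Proof.
move=> g_inj.
pose s1 := enum A ++ enum (~: A).
pose s2 := map g (enum A) ++ enum (~: (g @: A)).
have mem_s1 x : x \in s1 by rewrite mem_cat !mem_enum inE orbN.
have size_s : size s2 = size s1.
  rewrite !size_cat size_map -!cardE; congr (_ + _).
  by apply: (@addnI #|A|); rewrite cardsC -(card_in_imset g_inj) cardsC.
have uniq_s2 : uniq s2.
  rewrite cat_uniq enum_uniq andbT map_inj_in_uniq ?enum_uniq /=; last first.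
    by move=> x y; rewrite !mem_enum; apply: g_inj.
  apply/hasPn => y; rewrite mem_enum inE; apply: contra => /mapP[x].
  by rewrite mem_enum => xA ->; apply: imset_f.
have lt_index x : index x s1 < size s2 by rewrite size_s index_mem.
have pi_inj : injective (fun x => nth x s2 (index x s1)).
  (* The default of [nth] varies with the argument; as the index is in range, both sides can share
     one. *)
  move=> x y; rewrite (set_nth_default x y) // => /eqP.
  rewrite nth_uniq // => /eqP eq_xy.
  by rewrite -(nth_index x (mem_s1 x)) eq_xy nth_index.
exists (perm pi_inj) => x xA; rewrite permE.
have xA' : x \in enum A by rewrite mem_enum.
rewrite /s1 /s2 index_cat xA' nth_cat size_map index_mem xA'.
by rewrite (nth_map x) ?index_mem // nth_index.
Qed.

Section Embedding.
Variable G : simple_graph.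
Let H := valuation_graph G.

(* Each edge is recorded at only one of its ends, chosen by the enumeration
   of [G], so that the sum of the two valuations is the edge relation. *)
Definition valuation (x : G) : {ffun G -> bool} :=
  [ffun y => (enum_rank x < enum_rank y) && edge x y].

Definition valuation_embed (x : G) : H := (x, valuation x).

Lemma valuationD (x y : G) : valuation x y (+) valuation y x = edge x y.
Proof.
rewrite !ffunE (edge_sym y x).
case: ltngtP => [||/val_inj/enum_rank_inj ->]; rewrite ?addbF //.
by rewrite edge_irr.
Qed.

Lemma valuation_embedP : graph_embedding valuation_embed.
Proof.
split=> [x y [] //|x y]; rewrite /= /valuation_edge /= valuationD.
by have [->|] := eqVneq x y; rewrite ?edge_irr.
Qed.

Lemma switching_perm_extends (A S : {set G}) (pi : {perm G}) :
    S \subset A ->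
    {in A &, forall x y,
       edge (pi x) (pi y) = edge x y (+) ((x \in S) (+) (y \in S))} ->
  exists h : H -> H,
    graph_iso (h : switch [set p : H | p.1 \in S] -> H) /\
    {in A, forall x, h (valuation_embed x) = valuation_embed (pi x)}.
Proof.
move=> sSA pi_edge.
(* For [x] in [A], this correction is forced by sending the copy of [x] to that of [pi x]. *)
pose c x y := valuation x y (+) valuation (pi x) (pi y).
(* With only [y] in [A], the value solves the constraint [FD], where [x \in S] is false; with both
   outside, zero works because [S] lies in [A]. *)
pose F x y := if x \in A then c x y
              else (y \in A) && (c y x (+) (y \in S)).
have FD x y : F x y (+) F y x = (x \in S) (+) (y \in S).
  rewrite /F.
  have notS z : z \notin A -> (z \in S) = false.
    by apply: contraNF; apply/subsetP.
  have [xA|xA] := boolP (x \in A); have [yA|yA] := boolP (y \in A) => /=.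
  - rewrite /c addbACA !valuationD pi_edge //.
    by rewrite addbA addbb.
  - by rewrite (notS y) // addbF addbA addbb.
  - by rewrite (notS x) // addbAC addbb.
  - by rewrite !notS.
pose h (p : H) : H :=
  (pi p.1, [ffun z => p.2 (pi^-1 z)%g (+) F p.1 (pi^-1 z)%g]).
exists h; split; first split.
- apply: injF_bij => -[x chi] [y xi] [/perm_inj <- /ffunP eq_h].
  congr (_, _); apply/ffunP => z.
  by have := eq_h (pi z); rewrite !ffunE permK => /addIb.
- move=> [x chi] [y xi]; rewrite /= /switch_edge /= !inE /= /valuation_edge /=.
  rewrite (inj_eq perm_inj) !ffunE !permK.
  have [->|neq_xy] /= := eqVneq x y; first by rewrite eqxx.
  (* Regrouping leaves the old adjacency plus [F x y (+) F y x], which flips it exactly across the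
     cut. *)
  rewrite addbACA FD.
  by case: (x \in S); case: (y \in S); rewrite /= ?addbF ?addbT.
- move=> x xA; congr (_, _); apply/ffunP => z.
  by rewrite ffunE /F xA /c permKV addbA addbb.
Qed.

Lemma partial_switching_iso_extends (A B : {set G}) (f : induced A -> induced B)
    (S : {set induced A}) :
    graph_iso (f : switch S -> induced B) ->
  exists h : H -> H,
    graph_iso (h : switch [set p : H | p.1 \in val @: S] -> H) /\
    extends valuation_embed f h.
Proof.
move=> [/bij_inj f_inj f_edge].
(* The value outside [A] is a placeholder: [pi] agrees with [g] only on [A]. *)
pose g x := if insub x is Some u then val (f u) else x.
have gE (u : induced A) : g (val u) = val (f u) by rewrite /g valK.
have g_inj : {in A &, injective g}.
  move=> x y xA yA.
  by rewrite (gE (Sub x xA)) (gE (Sub y yA)) => /val_inj/f_inj[].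
have [pi piE] := injective_in_extends_perm g_inj.
have sSA : val @: S \subset A by apply/subsetP => _ /imsetP[u _ ->]; apply: valP.
have [|h [h_iso h_ext]] := switching_perm_extends (pi := pi) sSA.
  move=> x y xA yA; rewrite !piE //.
  rewrite -[x]/(val (Sub x xA : induced A)) -[y]/(val (Sub y yA : induced A)).
  set u : induced A := Sub x xA; set v : induced A := Sub y yA.
  rewrite !gE !(mem_imset _ _ val_inj).
  have := f_edge u v; rewrite /= /switch_edge /= /induced_edge => ->.
  by case: (u \in S); case: (v \in S); rewrite /= ?addbF ?addbT.
by exists h; split=> // u; rewrite h_ext ?piE ?gE //; apply: valP.
Qed.

End Embedding.

(** This reduces the claim on isomorphisms to the switching case: an empty switching set in [G]
    induces an empty one in [H]. *)
Lemma graph_iso_switch0 (G H : simple_graph) (f : G -> H) :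
  graph_iso (f : switch set0 -> H) <-> graph_iso f.
Proof.
by split=> -[f_bij f_edge]; split=> // x y;
  rewrite f_edge /= /switch_edge !inE.
Qed.

Theorem theorem1p3 (G : simple_graph) :
  exists (H : simple_graph) (e : G -> H),
    graph_embedding e /\
    (forall (A B : {set G}) (f : induced A -> induced B),
        switching_iso f -> exists h : H -> H, switching_aut h /\ extends e f h) /\
    (forall (A B : {set G}) (f : induced A -> induced B),
        graph_iso f -> exists h : H -> H, graph_aut h /\ extends e f h).
Proof.
exists (valuation_graph G), (@valuation_embed G).
split; first exact: valuation_embedP.
split=> A B f.
  move=> [S /partial_switching_iso_extends[h [h_iso h_ext]]].
  by exists h; split=> //; eexists; apply: h_iso.
move=> /graph_iso_switch0/partial_switching_iso_extends[h [h_iso h_ext]].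
exists h; split=> //; apply/graph_iso_switch0.
suff <- : [set p : valuation_graph G
            | p.1 \in val @: (set0 : {set induced A})] = set0 by [].
by apply/setP => p; rewrite imset0 !inE.
Qed.
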